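(* Let $P$ be the uniform probability distribution on the (closed) equilateral triangle $\triangle$ with vertices $(0,0)$, $(1,0)$, $(\frac12,\frac{\sqrt3}{2})$. Then there are exactly three optimal sets of two-means for $P$, and the corresponding quantization error is $V_2(P)=0.0532767$ (to seven decimal places). Moreover, if $\triangle$ is cut by a straight line parallel to one of its sides into an isosceles trapezoid and an equilateral triangle whose areas are in the golden ratio $g=\frac{1+\sqrt5}{2}$ (area of trapezoid : area of small triangle $= g$), then the centroids of the isosceles trapezoid and of the small equilateral triangle form an optimal set of two-means for $P$.
   Context: For a Borel probability measure $P$ on $\mathbb R^2$ with finite second moment and $n\ge1$, the $n$th quantization error is $V_n(P)=\inf\{\int \min_{a\in\alpha}\|x-a\|^2\,dP(x): \alpha\subset\mathbb R^2,\ \mathrm{card}(\alpha)\le n\}$, where $\|\cdot\|$ is the Euclidean norm. A set $\alpha$ with $\mathrm{card}(\alpha)\le n$ attaining this infimum is called an optimal set of $n$-means. The uniform distribution on $\triangle$ has density $\frac{4}{\sqrt3}$ on $\triangle$ and $0$ elsewhere. *)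

(* Defs.v *)
From HB Require Import structures.
From mathcomp Require Import all_boot all_order all_algebra finmap.
From mathcomp Require Import all_classical all_reals all_analysis.

Set Implicit Arguments.
Unset Strict Implicit.
Unset Printing Implicit Defensive.

Import Order.TTheory GRing.Theory Num.Theory.
Local Open Scope classical_set_scope.
Local Open Scope ring_scope.


Definition leb2 (R : realType) := ((@lebesgue_measure R) \x (@lebesgue_measure R))%E.
Arguments leb2 R : clear implicits.

Definition sqdist (R : realType) (p q : R * R) : R :=
  (p.1 - q.1) ^+ 2 + (p.2 - q.2) ^+ 2.

Definition tri (R : realType) : set (R * R) :=
  [set p | 0 <= p.2 /\ p.2 <= Num.sqrt 3 * p.1 /\ p.2 <= Num.sqrt 3 * (1 - p.1)].
Arguments tri R : clear implicits.

Definition tri_vertices (R : realType) : seq (R * R) :=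
  [:: (0, 0); (1, 0); (2^-1, Num.sqrt 3 / 2)].
Arguments tri_vertices R : clear implicits.

(** density of the uniform distribution P on the triangle *)
Definition dens (R : realType) : R := 4 / Num.sqrt 3.
Arguments dens R : clear implicits.

(** min_{a in alpha} ||x - a||^2, as an extended real (+oo for empty alpha) *)
Definition mindist (R : realType) (alpha : {fset (R * R)}) (x : R * R) : \bar R :=
  \big[Order.min/+oo%E]_(a <- alpha) ((sqdist x a)%:E).

(** distortion  int min_{a in alpha} ||x-a||^2 dP(x),  dP = dens * 1_tri d(leb2) *)
Definition distortion (R : realType) (alpha : {fset (R * R)}) : \bar R :=
  (\int[leb2 R]_(x in tri R) ((dens R)%:E * mindist alpha x))%E.

Definition Vn (R : realType) (n : nat) : \bar R :=
  ereal_inf [set distortion alpha | alpha in [set alpha : {fset (R * R)} | (#|` alpha|%fset <= n)%N]].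
Arguments Vn R n : clear implicits.

Definition optimal_set (R : realType) (n : nat) (alpha : {fset (R * R)}) : Prop :=
  (#|` alpha|%fset <= n)%N /\ distortion alpha = Vn R n.

Definition small_tri (R : realType) (v : R * R) (s : R) : set (R * R) :=
  [set (v.1 + s * (p.1 - v.1), v.2 + s * (p.2 - v.2)) | p in tri R].

(** centroid of a planar region A of finite positive area *)
Definition centroid (R : realType) (A : set (R * R)) : R * R :=
  (fine (\int[leb2 R]_(x in A) (x.1)%:E)%E / fine (leb2 R A),
   fine (\int[leb2 R]_(x in A) (x.2)%:E)%E / fine (leb2 R A)).

Definition golden (R : realType) : R := (1 + Num.sqrt 5) / 2.
Arguments golden R : clear implicits.

(* Main.v *)
(** Splitting the triangle into a part of mass [p] and its complement of mass
    [q = 1 - p], the best pair of points consists of the two centroids, and the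
    cost is the variance [1/12] minus [p |e|^2 / q], where [e] joins the centroid
    of the triangle to that of the first part.  A bisector that really cuts the
    triangle isolates one vertex, so it cuts off a corner with sides [s] and [t]
    along the two edges at that vertex; then [p = s t] and
    [|e|^2 = ((1-s)^2 + (1-t)^2 + (1-s)(1-t)) / 9].  This gain is maximal exactly
    at [s = t = phi = (sqrt 5 - 1) / 2], where it equals [phi^5 / 3].  The moments
    of a corner are pulled back to the standard simplex by an affine change of
    variables, itself obtained from one-dimensional affine substitutions and
    Tonelli's theorem. *)

Require Import Defs.
From HB Require Import structures.
From mathcomp Require Import all_boot all_order all_algebra finmap.
From mathcomp Require Import all_classical all_reals all_analysis.
From mathcomp Require Import measurable_realfun ring lra.

Set Implicit Arguments.
Unset Strict Implicit.
Unset Printing Implicit Defensive.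

Import Order.TTheory GRing.Theory Num.Theory.
Import numFieldNormedType.Exports.
Local Open Scope classical_set_scope.
Local Open Scope ring_scope.

(** The Borel structure is carried by [measurableTypeR R], so measurability in the plane is stated
    at this type, convertible to [R * R]. *)
Local Notation plane R := (measurableTypeR R * measurableTypeR R)%type.

(** * Affine change of variables in the plane *)

(** Uniqueness of Lebesgue measure: the scaled pushforward has the same values on half-open
    intervals. A negative slope exchanges their endpoints, hence two cases. *)
Lemma lebesgue_measure_affine (R : realType) (a b : R) (A : set R) :
  a != 0 -> measurable A ->
  lebesgue_measure A =
  (`|a|%:E * lebesgue_measure ((fun x => (a * x + b)%R) @^-1` A))%E.
Proof.
move=> a0 mA.
pose phi (x : measurableTypeR R) : measurableTypeR R := a * x + b.
have mphi : measurable_fun setT phi.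
  by apply: measurable_funD => //; apply: measurable_funM.
have na0 : 0 <= `|a| by [].
pose nu' := mscale (NngNum na0) (pushforward lebesgue_measure phi).
pose nu : {measure set (measurableTypeR R) -> \bar R} := nu' mphi.
suff : lebesgue_measure A = nu A by [].
apply: (@lebesgue_measure_unique R nu) => // _ [[c d]] _ <- /=.
rewrite /nu /mscale/= /pushforward/=.
case: (ltP 0 a) => [a_gt0|]; last rewrite le_eqVlt (negbTE a0)/= => a_lt0.
- have -> : phi @^-1` `]c, d] = `](c - b) / a, (d - b) / a]%classic.
    apply/seteqP; split=> x; rewrite /phi /= !in_itv/= ltr_pdivrMr// ler_pdivlMr//;
    by move=> /andP[? ?]; apply/andP; split; lra.
  rewrite !lebesgue_measure_itv/= !lte_fin ltr_pM2r ?invr_gt0//.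
  rewrite ltrD2r; case: ifPn => _; last by rewrite mule0.
  by rewrite -!EFinD -EFinM; congr EFin; rewrite gtr0_norm//; field.
- have -> : phi @^-1` `]c, d] = `[(d - b) / a, (c - b) / a[%classic.
    apply/seteqP; split=> x; rewrite /phi /= !in_itv/= ltr_ndivlMr// ler_ndivrMr//;
    by move=> /andP[? ?]; apply/andP; split; lra.
  rewrite !lebesgue_measure_itv/= !lte_fin ltr_nM2r ?invr_lt0//.
  rewrite ltrD2r; case: ifPn => _; last by rewrite mule0.
  by rewrite -!EFinD -EFinM; congr EFin; rewrite ltr0_norm//; field.
Qed.

Lemma ge0_integral_affine (R : realType) (a b : R) (f : R -> \bar R) :
  a != 0 -> measurable_fun setT f -> (forall x, 0 <= f x)%E ->
  (\int[lebesgue_measure]_x f x =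
   `|a|%:E * \int[lebesgue_measure]_x f (a * x + b)%R)%E.
Proof.
move=> a0 mf f0.
pose phi (x : measurableTypeR R) : measurableTypeR R := a * x + b.
have mphi : measurable_fun setT phi.
  by apply: measurable_funD => //; apply: measurable_funM.
have na0 : 0 <= `|a| by [].
pose nu' := mscale (NngNum na0) (pushforward lebesgue_measure phi).
pose nu : {measure set (measurableTypeR R) -> \bar R} := nu' mphi.
transitivity (\int[nu]_x f x)%E.
  apply: eq_measure_integral => A mA _.
  by rewrite [LHS](@lebesgue_measure_affine _ a b)// /nu /mscale.
rewrite ge0_integral_mscale//=; congr (_ * _)%E.
by rewrite ge0_integral_pushforward// => y _; exact: f0.
Qed.

Lemma ge0_integral_leb2 (R : realType) (F : R * R -> \bar R) :
  measurable_fun (setT : set (plane R)) F ->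
  (forall z, 0 <= F z)%E ->
  (\int[leb2 R]_z F z =
   \int[lebesgue_measure]_x \int[lebesgue_measure]_y F (x, y))%E.
Proof.
move=> mF F0.
exact: (@fubini_tonelli1 _ _ _ _ _ (@lebesgue_measure R) (@lebesgue_measure R) F).
Qed.

Lemma ge0_integral_leb2_swap (R : realType) (F : R * R -> \bar R) :
  measurable_fun (setT : set (plane R)) F ->
  (forall z, 0 <= F z)%E ->
  (\int[leb2 R]_z F z =
   \int[lebesgue_measure]_y \int[lebesgue_measure]_x F (x, y))%E.
Proof.
move=> mF F0.
exact: (@fubini_tonelli2 _ _ _ _ _ (@lebesgue_measure R) (@lebesgue_measure R) F).
Qed.

Definition affine_map (R : realType) (v u w z : R * R) : R * R :=
  (v.1 + z.1 * u.1 + z.2 * w.1, v.2 + z.1 * u.2 + z.2 * w.2).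

Definition det2 (R : realType) (u w : R * R) : R := u.1 * w.2 - u.2 * w.1.

Lemma measurable_affine_form (R : realType) (a b c : R) :
  measurable_fun setT
    (fun z : plane R => a + z.1 * b + z.2 * c).
Proof.
apply: measurable_funD; last by apply: measurable_funM => //.
by apply: measurable_funD => //; apply: measurable_funM.
Qed.

Lemma measurable_affine_map (R : realType) (v u w : R * R) :
  measurable_fun setT
    (affine_map v u w : plane R ->
                        plane R).
Proof.
by apply: measurable_fun_pair; apply: measurable_affine_form.
Qed.

(** The map factors as [(x, y) -> (v.1 + x * u.1 + y * w.1, y)] followed by [G]. Each factor changes
    one coordinate with the other fixed; the slopes [u.1] and [det2 u w / u.1] multiply to the
    determinant. *)
Lemma ge0_integral_affine_map (R : realType) (v u w : R * R)
    (F : R * R -> \bar R) :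
  u.1 != 0 -> det2 u w != 0 ->
  measurable_fun (setT : set (plane R)) F ->
  (forall z, 0 <= F z)%E ->
  (\int[leb2 R]_z F z = `|det2 u w|%:E * \int[leb2 R]_z F (affine_map v u w z))%E.
Proof.
move=> u0 d0 mF F0.
have d'0 : det2 u w / u.1 != 0 by rewrite mulf_neq0// invr_eq0.
pose k := u.2 / u.1.
pose G (z : R * R) : R * R := (z.1, (v.2 - k * v.1) + z.1 * k + z.2 * (det2 u w / u.1)).
have mG : measurable_fun (setT : set (plane R))
    (G : _ -> plane R).
  by apply: measurable_fun_pair => //; exact: measurable_affine_form.
have mFG : measurable_fun (setT : set (plane R)) (F \o G).
  exact: measurableT_comp.
have mFM : measurable_fun (setT : set (plane R))
  (F \o affine_map v u w) by apply: measurableT_comp => //; exact: measurable_affine_map.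
rewrite (ge0_integral_leb2 mF)// (ge0_integral_leb2_swap mFM)//=.
(* First factor: substitution in the second coordinate at fixed [x]. *)
transitivity (`|(det2 u w / u.1)%R|%:E * \int[leb2 R]_z (F \o G) z)%E.
  rewrite (ge0_integral_leb2 mFG)//=.
  rewrite -ge0_integralZl//=; first last.
  - by move=> x _; apply: integral_ge0.
  - exact: (@measurable_fun_fubini_tonelli_F _ _ _ _ _ (@lebesgue_measure R) _ mFG (fun z => F0 (G z))).
  apply: eq_integral => x _.
  rewrite (@ge0_integral_affine _ (det2 u w / u.1) (v.2 - k * v.1 + x * k))//.
    by congr (_ * _)%E; apply: eq_integral => y _; rewrite /fubini_F/= /G/=; congr F; congr pair; ring.
  exact/measurableT_comp.
(* The order of integration is exchanged, so that the first coordinate can be substituted at fixed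
   [y]. *)
rewrite (ge0_integral_leb2_swap mFG (fun z => F0 (G z)))/=.
rewrite normf_div EFinM -muleA; congr (_ * _)%E.
rewrite -ge0_integralZl//=; first last.
- by move=> x _; apply: integral_ge0.
- exact: (@measurable_fun_fubini_tonelli_G _ _ _ _ _ (@lebesgue_measure R) _ mFG (fun z => F0 (G z))).
apply: eq_integral => y _.
rewrite (@ge0_integral_affine _ u.1 (v.1 + y * w.1))//.
  rewrite muleA -EFinM mulVf ?normr_eq0// mul1e.
  apply: eq_integral => x _; rewrite /= /G /affine_map /=; congr F.
  by congr pair; rewrite /k /det2; field.
by apply: (measurableT_comp mFG); exact: pair2_measurable.
Qed.

(** * Integrals over the standard simplex *)

(** Degree three suffices: a quadratic polynomial integrated over a vertical section of the simplex
    leaves a cubic in [x]. *)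
Lemma integral_cubic (R : realType) (a0 a1 a2 a3 r : R) : 0 <= r ->
  (\int[lebesgue_measure]_(x in `[0%R, r])
     (a0 + a1 * x + a2 * x ^+ 2 + a3 * x ^+ 3)%:E =
   (a0 * r + a1 * r ^+ 2 / 2 + a2 * r ^+ 3 / 3 + a3 * r ^+ 4 / 4)%:E)%E.
Proof.
(* The fundamental theorem of calculus is applied on a nondegenerate interval, so [r = 0] is settled
   first. *)
rewrite le_eqVlt => /predU1P[<-|r0].
  by rewrite set_itv1 integral_set1; congr EFin; rewrite !expr0n/=; ring.
pose p : {poly R} :=
  a0 *: 'X + (a1 / 2) *: 'X^2 + (a2 / 3) *: 'X^3 + (a3 / 4) *: 'X^4.
have dp x : p^`().[x] = a0 + a1 * x + a2 * x ^+ 2 + a3 * x ^+ 3.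
  by rewrite /p !poly.derivE !(hornerE, hornerMn)/=; field.
under eq_integral do rewrite -dp.
rewrite (@continuous_FTC2 R (horner p^`()) (horner p) 0 r)//.
- by rewrite -EFinD /p !hornerE /=; congr EFin; field.
- exact/continuous_subspaceT/continuous_horner.
- split.
  + by move=> x _; exact: derivable_horner.
  + by apply: cvg_at_right_filter; exact: continuous_horner.
  + by apply: cvg_at_left_filter; exact: continuous_horner.
- by move=> x _; rewrite derive.derivE.
Qed.

Lemma measurable_halfplane (R : realType) (a b c : R) :
  measurable ([set z | 0 <= a + z.1 * b + z.2 * c]
    : set (plane R)).
Proof.
have := @measurable_affine_form R a b c measurableT `[0, +oo[%classic (measurable_itv _).
rewrite setTI; congr (measurable _); apply/seteqP.
by split=> z /=; rewrite in_itv/= andbT.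
Qed.

Definition std_tri (R : realType) : set (R * R) :=
  [set z | 0 <= z.1 /\ 0 <= z.2 /\ z.1 + z.2 <= 1].
Arguments std_tri R : clear implicits.

Lemma measurable_std_tri (R : realType) :
  measurable (std_tri R : set (plane R)).
Proof.
suff -> : std_tri R = [set z : R * R | 0 <= 0 + z.1 * 1 + z.2 * 0] `&`
   ([set z | 0 <= 0 + z.1 * 0 + z.2 * 1] `&`
    [set z | 0 <= 1 + z.1 * (-1) + z.2 * (-1)]).
  by apply: measurableI; [|apply: measurableI]; exact: measurable_halfplane.
by apply/seteqP; split=> z /= [? [? ?]]; split; [|split| |split]; lra.
Qed.

Section affine_image.
Variables (R : realType) (v u w : R * R).
Hypotheses (u0 : u.1 != 0) (det0 : det2 u w != 0).

(** Cramer's rule. The explicit inverse turns images into preimages, whose measurability is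
    immediate. *)
Definition affine_inv (z : R * R) : R * R :=
  ((w.2 * (z.1 - v.1) - w.1 * (z.2 - v.2)) / det2 u w,
   (u.1 * (z.2 - v.2) - u.2 * (z.1 - v.1)) / det2 u w).

Lemma affine_mapK : cancel (affine_map v u w) affine_inv.
Proof.
move=> [x y]; rewrite /affine_map /affine_inv /=; move: det0; rewrite /det2 => d0.
by congr pair; field.
Qed.

Lemma affine_invK : cancel affine_inv (affine_map v u w).
Proof.
move=> [x y]; rewrite /affine_map /affine_inv /= [RHS]surjective_pairing /=.
by move: det0; rewrite /det2 => d0; congr pair; field.
Qed.

Lemma affine_image_preimage (D : set (R * R)) :
  affine_map v u w @` D = affine_inv @^-1` D.
Proof.
apply/seteqP; split=> [_ [z Dz <-]|z Dz] /=; first by rewrite affine_mapK.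
by exists (affine_inv z) => //; rewrite affine_invK.
Qed.

Lemma measurable_affine_image (D : set (plane R)) :
  measurable D ->
  measurable (affine_map v u w @` D : set (plane R)).
Proof.
move=> mD; rewrite affine_image_preimage -[X in measurable X]setTI.
have -> : affine_inv = affine_map
   ((w.1 * v.2 - w.2 * v.1) / det2 u w, (u.2 * v.1 - u.1 * v.2) / det2 u w)
   (w.2 / det2 u w, - u.2 / det2 u w) (- w.1 / det2 u w, u.1 / det2 u w).
  apply/funext => z; rewrite /affine_inv /affine_map /=; congr pair; ring.
exact: measurable_affine_map.
Qed.

Lemma ge0_integral_affine_image (D : set (R * R)) (f : R * R -> R) :
  measurable (D : set (plane R)) ->
  measurable_fun (setT : set (plane R)) f ->
  (forall z, D z -> 0 <= f (affine_map v u w z)) ->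
  (\int[leb2 R]_(z in affine_map v u w @` D) (f z)%:E =
   `|det2 u w|%:E * \int[leb2 R]_(z in D) (f (affine_map v u w z))%:E)%E.
Proof.
move=> mD mf f0.
rewrite integral_mkcond (@ge0_integral_affine_map R v u w)//; first last.
- move=> z; apply: erestrict_ge0 => _ [z' Dz' <-].
  by rewrite lee_fin f0.
- apply/(measurable_restrictT _ _).1 => //; first exact: measurable_affine_image.
  apply: measurable_funTS; exact/measurable_EFinP.
congr (_ * _)%E; rewrite [RHS]integral_mkcond; apply: eq_integral => z _.
rewrite !patchE; congr (if _ then _ else _).
by rewrite affine_image_preimage; apply/idP/idP; rewrite !inE /= affine_mapK.
Qed.

End affine_image.

(** Constants, coordinates and squared distances all pull back to this form under an affine map, so
    one formula serves areas, centroids and costs. *)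
Definition quad (R : realType) (c0 c1 c2 c3 c4 c5 : R) (z : R * R) : R :=
  c0 + c1 * z.1 + c2 * z.2 + c3 * z.1 ^+ 2 + c4 * (z.1 * z.2) + c5 * z.2 ^+ 2.

Lemma measurable_quad (R : realType) (c0 c1 c2 c3 c4 c5 : R)
    (D : set (plane R)) :
  measurable_fun D (quad c0 c1 c2 c3 c4 c5).
Proof.
apply: measurable_funTS.
by rewrite /quad; repeat apply: measurable_funD => //; apply: measurable_funM => //;
  [apply: measurable_funX|apply: measurable_funM|apply: measurable_funX].
Qed.

Lemma integral_std_tri_quad (R : realType) (c0 c1 c2 c3 c4 c5 : R) :
  (forall z, std_tri R z -> 0 <= quad c0 c1 c2 c3 c4 c5 z) ->
  (\int[leb2 R]_(z in std_tri R) (quad c0 c1 c2 c3 c4 c5 z)%:E =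
   (c0 / 2 + c1 / 6 + c2 / 6 + c3 / 12 + c4 / 24 + c5 / 12)%:E)%E.
Proof.
move=> q0.
rewrite integral_mkcond ge0_integral_leb2; first last.
- by move=> z; apply: erestrict_ge0 => z' Dz'; rewrite lee_fin q0.
- apply/(measurable_restrictT _ _).1 => //; first exact: measurable_std_tri.
  by apply/measurable_EFinP; exact: measurable_quad.
(* The [b0] to [b3] are the coefficients in [x] of the inner integral over [y] in [[0, 1 - x]]. *)
pose b0 : R := c0 + c2 / 2 + c5 / 3.
pose b1 : R := c1 - c0 + (c4 / 2 - c2) - c5.
pose b2 : R := c3 - c1 + (c2 / 2 - c4) + c5.
pose b3 : R := - c3 + c4 / 2 - c5 / 3.
transitivity (\int[lebesgue_measure]_(x in `[0%R, 1%R])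
     (b0 + b1 * x + b2 * x ^+ 2 + b3 * x ^+ 3)%:E)%E; last first.
  by rewrite integral_cubic//; congr EFin; rewrite /b0 /b1 /b2 /b3; field.
rewrite [RHS]integral_mkcond; apply: eq_integral => x _.
rewrite patchE; case: ifPn; rewrite ?notin_setE ?inE /= in_itv/=.
- move=> /andP[x0 x1].
  transitivity (\int[lebesgue_measure]_(y in `[0%R, (1 - x)%R])
     ((c0 + c1 * x + c3 * x ^+ 2) + (c2 + c4 * x) * y + c5 * y ^+ 2 + 0 * y ^+ 3)%:E)%E.
    rewrite [RHS]integral_mkcond; apply: eq_integral => y _.
    rewrite !patchE; have -> : ((x, y) \in std_tri R) = (y \in `[0, (1 - x)]%classic).
      apply/idP/idP; rewrite !inE/= in_itv/=.
        by rewrite /std_tri/= => -[? [? ?]]; apply/andP; split; lra.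
      by move=> /andP[? ?]; rewrite /std_tri /=; split; [|split] => //; lra.
    by case: ifP => // _; congr EFin; rewrite /quad/=; ring.
  rewrite integral_cubic ?subr_ge0//; congr EFin.
  by rewrite /b0 /b1 /b2 /b3; field.
- move=> xN; apply: integral0_eq => y _; rewrite patchE ifF//.
  apply/negbTE; rewrite notin_setE /std_tri/= => -[? [? ?]].
  by apply: xN; apply/andP; split; lra.
Qed.

(** * Corners of the equilateral triangle *)

Definition scl (R : realType) (s : R) (u : R * R) : R * R := (s * u.1, s * u.2).

Definition tri_center (R : realType) : R * R := (2^-1, Num.sqrt 3 / 6).
Arguments tri_center R : clear implicits, simpl never.

Lemma sqr_sqrt3 (R : realType) : Num.sqrt 3 * Num.sqrt 3 = 3 :> R.
Proof. by rewrite -expr2 sqr_sqrtr. Qed.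

Lemma sqrt3_gt0 (R : realType) : 0 < Num.sqrt 3 :> R.
Proof. by rewrite sqrtr_gt0. Qed.

Lemma dens_gt0 (R : realType) : 0 < dens R.
Proof. by rewrite /dens divr_gt0// sqrt3_gt0. Qed.

(** A vertex [v] with the unit edge vectors [u] and [w] leaving it. These facts let every
    computation be done once for all three vertices; the determinant is taken in absolute value
    because orientations differ. *)
Record frame (R : realType) (v u w : R * R) : Prop := Frame {
  frame_u1 : u.1 != 0;
  frame_det : `|det2 u w| = Num.sqrt 3 / 2;
  frame_u : u.1 * u.1 + u.2 * u.2 = 1;
  frame_w : w.1 * w.1 + w.2 * w.2 = 1;
  frame_uw : u.1 * w.1 + u.2 * w.2 = 2^-1;
  frame_c1 : v.1 + (u.1 + w.1) / 3 = (tri_center R).1;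
  frame_c2 : v.2 + (u.2 + w.2) / 3 = (tri_center R).2;
  frame_tri : affine_map v u w @` std_tri R = tri R }.

(** In the variables [p.1] and [p.2 / Num.sqrt 3] the constraints have rational coefficients, within
    reach of [lra]. *)
Lemma in_triE (R : realType) (p : R * R) :
  tri R p <-> [/\ 0 <= p.2 / Num.sqrt 3, p.2 / Num.sqrt 3 <= p.1 &
                  p.2 / Num.sqrt 3 <= 1 - p.1].
Proof.
rewrite /tri /= ler_pdivlMr ?sqrt3_gt0// mul0r.
by rewrite !ler_pdivrMr ?sqrt3_gt0// ![_ * Num.sqrt 3]mulrC; split => [[? [? ?]]|[]].
Qed.

Section frames.
Variable R : realType.
Let k : R := Num.sqrt 3.

Lemma frame1 : frame (0, 0) (1, 0) (2^-1, k / 2).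
Proof.
have kk : k * k = 3 := sqr_sqrt3 R; have k0 : 0 < k := sqrt3_gt0 R.
have kn0 : k != 0 by rewrite gt_eqF.
have T : affine_map (0, 0) (1, 0) (2^-1, k / 2) @` std_tri R = tri R.
  apply/seteqP; split=> [_ [z [z1 [z2 z12]] <-]|p].
    apply/in_triE; rewrite /affine_map/= -/k.
    have -> : (0 + z.1 * 0 + z.2 * (k / 2)) / k = z.2 / 2 by field.
    by split; lra.
  move=> /in_triE[]; rewrite -/k => p1 p2 p3.
  (* Barycentric coordinates of [p] at the ends of [u] and [w]. *)
  exists (p.1 - p.2 / k, 2 * (p.2 / k)).
    by rewrite /std_tri/=; split; [|split]; lra.
  rewrite /affine_map/= [RHS]surjective_pairing; congr pair; first by field.
  by field.
split; last exact: T; clear T; rewrite /det2 /tri_center -/k /=; try lra; rewrite ?oner_eq0//.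
by rewrite ger0_norm; lra.
Qed.

Lemma frame2 : frame (1, 0) (-1, 0) (- 2^-1, k / 2).
Proof.
have kk : k * k = 3 := sqr_sqrt3 R; have k0 : 0 < k := sqrt3_gt0 R.
have kn0 : k != 0 by rewrite gt_eqF.
have T : affine_map (1, 0) (-1, 0) (- 2^-1, k / 2) @` std_tri R = tri R.
  apply/seteqP; split=> [_ [z [z1 [z2 z12]] <-]|p].
    apply/in_triE; rewrite /affine_map/= -/k.
    have -> : (0 + z.1 * 0 + z.2 * (k / 2)) / k = z.2 / 2 by field.
    by split; lra.
  move=> /in_triE[]; rewrite -/k => p1 p2 p3.
  exists (1 - p.1 - p.2 / k, 2 * (p.2 / k)).
    by rewrite /std_tri/=; split; [|split]; lra.
  rewrite /affine_map/= [RHS]surjective_pairing; congr pair; first by field.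
  by field.
split; last exact: T; clear T; rewrite /det2 /tri_center -/k /=; try lra; rewrite ?oppr_eq0 ?oner_eq0//.
by rewrite ler0_norm; lra.
Qed.

Lemma frame3 : frame (2^-1, k / 2) (- 2^-1, - (k / 2)) (2^-1, - (k / 2)).
Proof.
have kk : k * k = 3 := sqr_sqrt3 R; have k0 : 0 < k := sqrt3_gt0 R.
have kn0 : k != 0 by rewrite gt_eqF.
have T : affine_map (2^-1, k / 2) (- 2^-1, - (k / 2)) (2^-1, - (k / 2)) @` std_tri R = tri R.
  apply/seteqP; split=> [_ [z [z1 [z2 z12]] <-]|p].
    apply/in_triE; rewrite /affine_map/= -/k.
    have -> : (k / 2 + z.1 * - (k / 2) + z.2 * - (k / 2)) / k = (1 - z.1 - z.2) / 2.
      by field.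
    by split; lra.
  move=> /in_triE[]; rewrite -/k => p1 p2 p3.
  exists (1 - p.1 - p.2 / k, p.1 - p.2 / k).
    by rewrite /std_tri/=; split; [|split]; lra.
  rewrite /affine_map/= [RHS]surjective_pairing; congr pair; first by field.
  by field.
have k4 : k / 2 * (k / 2) = 3 / 4 by rewrite -kk; field.
split; last exact: T; clear T; rewrite /det2 /tri_center -/k /=; try lra; rewrite ?oppr_eq0 ?invr_eq0 ?pnatr_eq0//.
by rewrite ger0_norm; lra.
Qed.

End frames.

Lemma frame_det_neq0 (R : realType) (v u w : R * R) :
  frame v u w -> det2 u w != 0.
Proof.
move=> fr; rewrite -normr_eq0 (frame_det fr).
by rewrite mulf_neq0// ?invr_eq0 ?pnatr_eq0// gt_eqF// sqrt3_gt0.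
Qed.

Lemma measurable_tri (R : realType) :
  measurable (tri R : set (plane R)).
Proof.
rewrite -(frame_tri (frame1 R)).
exact: (@measurable_affine_image R _ _ _ (frame_det_neq0 (frame1 R)) _ (@measurable_std_tri R)).
Qed.

(** * Integrals over corners *)

Section corner.
Variables (R : realType) (v u w : R * R).
Hypothesis fr : frame v u w.

Definition corner (s t : R) : set (R * R) :=
  affine_map v (scl s u) (scl t w) @` std_tri R.

(** The mean of the three vertices [v], [v + s u] and [v + t w]. *)
Definition corner_centroid (s t : R) : R * R :=
  (v.1 + (s * u.1 + t * w.1) / 3, v.2 + (s * u.2 + t * w.2) / 3).

Lemma det2_scl (s t : R) : det2 (scl s u) (scl t w) = s * t * det2 u w.
Proof. by rewrite /det2 /scl/=; ring. Qed.

Lemma det2_scl_neq0 (s t : R) : 0 < s -> 0 < t ->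
  det2 (scl s u) (scl t w) != 0.
Proof.
move=> s0 t0; rewrite det2_scl mulf_neq0 ?(frame_det_neq0 fr)//.
by rewrite gt_eqF// mulr_gt0.
Qed.

Lemma measurable_corner (s t : R) : 0 < s -> 0 < t ->
  measurable (corner s t : set (plane R)).
Proof.
move=> s0 t0.
exact: (@measurable_affine_image R _ _ _ (det2_scl_neq0 s0 t0) _ (@measurable_std_tri R)).
Qed.

Lemma affine_map_scl (s t : R) (z : R * R) :
  affine_map v (scl s u) (scl t w) z = affine_map v u w (s * z.1, t * z.2).
Proof. by rewrite /affine_map /scl/=; congr pair; ring. Qed.

Lemma corner1 : corner 1 1 = tri R.
Proof.
rewrite -(frame_tri fr); apply/seteqP; split=> _ [z Dz <-]; exists z => //;
by rewrite /affine_map /scl /= !mul1r.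
Qed.

Lemma corner_sub_tri (s t : R) : 0 < s <= 1 -> 0 < t <= 1 ->
  corner s t `<=` tri R.
Proof.
move=> /andP[s0 s1] /andP[t0 t1] _ [z [z1 [z2 z12]] <-].
rewrite affine_map_scl -(frame_tri fr); exists (s * z.1, t * z.2) => //.
have ? : s * z.1 <= z.1 by rewrite ler_piMl.
have ? : t * z.2 <= z.2 by rewrite ler_piMl.
by rewrite /std_tri/=; split; [|split]; rewrite ?mulr_ge0 ?(ltW s0) ?(ltW t0)//; lra.
Qed.

Lemma integral_corner (s t c0 c1 c2 c3 c4 c5 : R) (f : R * R -> R) :
  0 < s -> 0 < t ->
  measurable_fun (setT : set (plane R)) f ->
  (forall z, corner s t z -> 0 <= f z) ->
  (forall z, f (affine_map v (scl s u) (scl t w) z) = quad c0 c1 c2 c3 c4 c5 z) ->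
  (\int[leb2 R]_(z in corner s t) (f z)%:E =
   (Num.sqrt 3 / 2 * (s * t) *
    (c0 / 2 + c1 / 6 + c2 / 6 + c3 / 12 + c4 / 24 + c5 / 12))%:E)%E.
Proof.
move=> s0 t0 mf f0 fq.
rewrite /corner ge0_integral_affine_image//; first last.
- by move=> z Dz; apply: f0; exists z.
- exact: measurable_std_tri.
- exact: det2_scl_neq0.
- by rewrite /scl/= mulf_neq0 ?(frame_u1 fr)// gt_eqF.
under eq_integral do rewrite fq.
rewrite integral_std_tri_quad; last first.
  by move=> z Dz; rewrite -fq; apply: f0; exists z.
rewrite -EFinM det2_scl normrM (frame_det fr) gtr0_norm ?mulr_gt0//.
by congr EFin; ring.
Qed.

Lemma integral_tri (c0 c1 c2 c3 c4 c5 : R) (f : R * R -> R) :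
  measurable_fun (setT : set (plane R)) f ->
  (forall z, tri R z -> 0 <= f z) ->
  (forall z, f (affine_map v u w z) = quad c0 c1 c2 c3 c4 c5 z) ->
  (\int[leb2 R]_(z in tri R) (f z)%:E =
   (Num.sqrt 3 / 2 *
    (c0 / 2 + c1 / 6 + c2 / 6 + c3 / 12 + c4 / 24 + c5 / 12))%:E)%E.
Proof.
move=> mf f0 fq; rewrite -corner1 (@integral_corner 1 1 c0 c1 c2 c3 c4 c5)//.
- by rewrite !mulr1.
- by rewrite corner1.
- by move=> z; rewrite affine_map_scl !mul1r -surjective_pairing.
Qed.

End corner.

(** Additivity over the disjoint union; the real values [x] and [y] make the subtraction of extended
    reals legitimate. *)
Lemma integral_setD_tri (R : realType) (A : set (R * R)) (f : R * R -> R) (x y : R) :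
  measurable (A : set (plane R)) ->
  A `<=` tri R ->
  measurable_fun (setT : set (plane R)) f ->
  (forall z, tri R z -> 0 <= f z) ->
  (\int[leb2 R]_(z in tri R) (f z)%:E = x%:E)%E ->
  (\int[leb2 R]_(z in A) (f z)%:E = y%:E)%E ->
  (\int[leb2 R]_(z in tri R `\` A) (f z)%:E = (x - y)%:E)%E.
Proof.
move=> mA AT mf f0 Ex Ey; rewrite EFinB -Ex -Ey.
rewrite -{2}(setDUK AT) ge0_integral_setU//; first last.
- by rewrite disj_set2E setDIK.
- by move=> z; rewrite setDUK// => /f0; rewrite lee_fin.
- by apply: measurable_funTS; exact/measurable_EFinP.
- exact: measurableD (@measurable_tri R) mA.
by rewrite Ey addeAC subee// add0e.
Qed.

(** * Distortion of a pair of points *)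

Lemma sqdist_ge0 (R : realType) (p q : R * R) : 0 <= sqdist p q.
Proof. by rewrite addr_ge0 ?sqr_ge0. Qed.

Lemma mindist_le (R : realType) (alpha : {fset R * R}) (a x : R * R) :
  a \in alpha -> (mindist alpha x <= (sqdist x a)%:E)%E.
Proof. by move=> aA; rewrite /mindist ge_bigmin_seq. Qed.

Lemma le_mindist (R : realType) (alpha : {fset R * R}) (m : \bar R) (x : R * R) :
  (forall a, a \in alpha -> (m <= (sqdist x a)%:E)%E) -> (m <= mindist alpha x)%E.
Proof.
move=> mle; rewrite /mindist big_seq_cond; apply: le_bigmin => [|a]; first exact: leey.
by rewrite andbT; exact: mle.
Qed.

Lemma mindist2 (R : realType) (a b x : R * R) :
  mindist [fset a; b]%fset x = (Num.min (sqdist x a) (sqdist x b))%:E.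
Proof.
apply/eqP; rewrite eq_le; apply/andP; split.
  rewrite EFin_min le_min !mindist_le//.
    by rewrite !inE eqxx orbT.
  by rewrite !inE eqxx.
apply: le_mindist => c; rewrite !inE => /orP[/eqP->|/eqP->]; rewrite lee_fin.
  by rewrite ge_min lexx.
by rewrite ge_min lexx orbT.
Qed.

Definition wdist (R : realType) (a x : R * R) : R := dens R * sqdist x a.

Lemma wdist_ge0 (R : realType) (a x : R * R) : 0 <= wdist a x.
Proof. by rewrite mulr_ge0 ?sqdist_ge0// ltW// dens_gt0. Qed.

Lemma measurable_wdist (R : realType) (a : R * R)
    (D : set (plane R)) :
  measurable_fun D (wdist a).
Proof.
have -> : wdist a = quad (dens R * (a.1 ^+ 2 + a.2 ^+ 2)) (dens R * - (a.1 *+ 2))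
    (dens R * - (a.2 *+ 2)) (dens R) 0 (dens R).
  by apply/funext => x; rewrite /wdist /sqdist /quad; ring.
exact: measurable_quad.
Qed.

Lemma distortion2 (R : realType) (a b : R * R) :
  distortion [fset a; b]%fset =
  (\int[leb2 R]_(x in tri R) (Num.min (wdist a x) (wdist b x))%:E)%E.
Proof.
apply: eq_integral => x _; rewrite mindist2 -EFinM; congr EFin.
by rewrite /wdist minr_pMr// ltW// dens_gt0.
Qed.

Lemma distortion2_split (R : realType) (A : set (R * R)) (a b : R * R) :
  measurable (A : set (plane R)) ->
  A `<=` tri R ->
  (distortion [fset a; b]%fset =
   \int[leb2 R]_(x in A) (Num.min (wdist a x) (wdist b x))%:E +
   \int[leb2 R]_(x in tri R `\` A) (Num.min (wdist a x) (wdist b x))%:E)%E.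
Proof.
move=> mA AT; rewrite distortion2 -{1}(setDUK AT) ge0_integral_setU//.
- exact: measurableD (@measurable_tri R) mA.
- by apply/measurable_EFinP/measurable_minr; exact: measurable_wdist.
- by move=> z _; rewrite lee_fin le_min !wdist_ge0.
- by rewrite disj_set2E setDIK.
Qed.

(** Serving [A] by [a] and the rest by [b] costs pointwise at least the minimum, whatever [A] is. *)
Lemma distortion2_le_split (R : realType) (A : set (R * R)) (a b : R * R) :
  measurable (A : set (plane R)) ->
  A `<=` tri R ->
  (distortion [fset a; b]%fset <=
   \int[leb2 R]_(x in A) (wdist a x)%:E +
   \int[leb2 R]_(x in tri R `\` A) (wdist b x)%:E)%E.
Proof.
move=> mA AT; rewrite (distortion2_split _ _ mA AT); apply: leeD.
  apply: ge0_le_integral => //.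
  - by move=> z _; rewrite lee_fin le_min !wdist_ge0.
  - by apply/measurable_EFinP/measurable_minr; exact: measurable_wdist.
  - by apply/measurable_EFinP; exact: measurable_wdist.
  - by move=> z _; rewrite lee_fin ge_min lexx.
apply: ge0_le_integral => //.
- exact: measurableD (@measurable_tri R) mA.
- by move=> z _; rewrite lee_fin le_min !wdist_ge0.
- by apply/measurable_EFinP/measurable_minr; exact: measurable_wdist.
- by apply/measurable_EFinP; exact: measurable_wdist.
- by move=> z _; rewrite lee_fin ge_min lexx orbT.
Qed.

(** The hypotheses make [A] a Voronoi cell of [a] in the triangle, so the minimum is known on each
    side. *)
Lemma distortion2_eq_split (R : realType) (A : set (R * R)) (a b : R * R) :
  measurable (A : set (plane R)) ->
  A `<=` tri R ->
  (forall x, A x -> sqdist x a <= sqdist x b) ->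
  (forall x, tri R x -> ~ A x -> sqdist x b <= sqdist x a) ->
  (distortion [fset a; b]%fset =
   \int[leb2 R]_(x in A) (wdist a x)%:E +
   \int[leb2 R]_(x in tri R `\` A) (wdist b x)%:E)%E.
Proof.
move=> mA AT ab ba; rewrite (distortion2_split _ _ mA AT); congr (_ + _)%E.
  apply: eq_integral => x /[!inE] /ab xab; congr EFin.
  by apply/min_idPl; rewrite ler_pM2l// dens_gt0.
apply: eq_integral => x /[!inE] -[xT xA]; congr EFin.
by apply/min_idPr; rewrite ler_pM2l ?dens_gt0//; exact: ba.
Qed.

(** * Cost of splitting off a corner *)

Section frame_cost.
Variables (R : realType) (v u w : R * R).
Hypothesis fr : frame v u w.

Local Notation corner := (corner v u w).
Local Notation ctr := (corner_centroid v u w).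

Lemma corner_centroid1 : ctr 1 1 = tri_center R.
Proof.
rewrite /corner_centroid !mul1r (frame_c1 fr) (frame_c2 fr).
by rewrite -surjective_pairing.
Qed.

(* [(2 s^2 + 2 t^2 - s t) / 36] is the variance of the uniform law on a triangle
   with sides [s] and [t] enclosing an angle of 60 degrees. *)
Lemma integral_corner_wdist (s t : R) (a : R * R) : 0 < s -> 0 < t ->
  (\int[leb2 R]_(x in corner s t) (wdist a x)%:E =
   (s * t * (sqdist (ctr s t) a + (2 * s ^+ 2 + 2 * t ^+ 2 - s * t) / 36))%:E)%E.
Proof.
move=> s0 t0.
pose d : R * R := (v.1 - a.1, v.2 - a.2).
have uu := frame_u fr; have ww := frame_w fr; have uw := frame_uw fr.
rewrite (@integral_corner _ _ _ _ fr s t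
  (dens R * (d.1 ^+ 2 + d.2 ^+ 2)) (dens R * (2 * s * (d.1 * u.1 + d.2 * u.2)))
  (dens R * (2 * t * (d.1 * w.1 + d.2 * w.2))) (dens R * s ^+ 2)
  (dens R * (s * t)) (dens R * t ^+ 2))//.
- congr EFin; rewrite /dens /sqdist /corner_centroid /d/=.
  have k0 : Num.sqrt 3 != 0 :> R by rewrite gt_eqF// sqrt3_gt0.
  transitivity (s * t * ((v.1 - a.1) ^+ 2 + (v.2 - a.2) ^+ 2
     + 2 / 3 * (s * ((v.1 - a.1) * u.1 + (v.2 - a.2) * u.2)
              + t * ((v.1 - a.1) * w.1 + (v.2 - a.2) * w.2))
     + (s ^+ 2 + t ^+ 2) / 6 + s * t / 12)); first by field.
  congr (_ * _).
  (* The numbers [1] and [1/2] are expanded back into inner products of [u] and [w], which leaves a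
     polynomial identity in the coordinates. *)
  have -> : (2 * s ^+ 2 + 2 * t ^+ 2 - s * t) / 36 =
    (2 * s ^+ 2 * (u.1 * u.1 + u.2 * u.2) + 2 * t ^+ 2 * (w.1 * w.1 + w.2 * w.2)
     - 2 * s * t * (u.1 * w.1 + u.2 * w.2)) / 36 by rewrite uu ww uw; field.
  have -> : s * t / 12 = s * t * (u.1 * w.1 + u.2 * w.2) / 6 by rewrite uw; field.
  have -> : (s ^+ 2 + t ^+ 2) / 6 = (s ^+ 2 * (u.1 * u.1 + u.2 * u.2)
    + t ^+ 2 * (w.1 * w.1 + w.2 * w.2)) / 6 by rewrite uu ww !mulr1.
  by field.
- exact: measurable_wdist.
- by move=> z _; exact: wdist_ge0.
- move=> z; rewrite /wdist /quad /sqdist /affine_map /scl /d /=.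
  have -> : dens R * s ^+ 2 = dens R * s ^+ 2 * (u.1 * u.1 + u.2 * u.2) by rewrite uu mulr1.
  have -> : dens R * t ^+ 2 = dens R * t ^+ 2 * (w.1 * w.1 + w.2 * w.2) by rewrite ww mulr1.
  have -> : dens R * (s * t) = dens R * (s * t) * (2 * (u.1 * w.1 + u.2 * w.2)).
    by rewrite uw mulfV ?pnatr_eq0// mulr1.
  by ring.
Qed.

Lemma integral_tri_wdist (a : R * R) :
  (\int[leb2 R]_(x in tri R) (wdist a x)%:E = (sqdist (tri_center R) a + 12^-1)%:E)%E.
Proof.
rewrite -(corner1 fr) integral_corner_wdist// corner_centroid1.
by congr EFin; field.
Qed.

(** Cost of [b] on the whole triangle, minus its cost on the corner, plus that of [a] there; the
    variance of the corner cancels. *)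
Definition split_cost (s t : R) (a b : R * R) : R :=
  12^-1 + s * t * sqdist (ctr s t) a + sqdist (tri_center R) b
  - s * t * sqdist (ctr s t) b.

Lemma integral_split (s t : R) (a b : R * R) : 0 < s <= 1 -> 0 < t <= 1 ->
  (\int[leb2 R]_(x in corner s t) (wdist a x)%:E +
   \int[leb2 R]_(x in tri R `\` corner s t) (wdist b x)%:E =
   (split_cost s t a b)%:E)%E.
Proof.
move=> s01 t01; have [/andP[s0 _] /andP[t0 _]] := (s01, t01).
rewrite (integral_setD_tri (measurable_corner fr s0 t0) (corner_sub_tri fr s01 t01)
  (@measurable_wdist R b setT) (fun z _ => wdist_ge0 b z)
  (integral_tri_wdist b) (integral_corner_wdist b s0 t0)).
rewrite integral_corner_wdist// -EFinD; congr EFin.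
by rewrite /split_cost; ring.
Qed.

Lemma distortion2_le_split_cost (s t : R) (a b : R * R) :
  0 < s <= 1 -> 0 < t <= 1 ->
  (distortion [fset a; b]%fset <= (split_cost s t a b)%:E)%E.
Proof.
move=> s01 t01; have [/andP[s0 _] /andP[t0 _]] := (s01, t01).
rewrite -integral_split//; apply: distortion2_le_split.
- exact: (@measurable_corner R v u w fr s t s0 t0).
- exact: corner_sub_tri.
Qed.

Definition dist_gap (a b x : R * R) : R := sqdist x a - sqdist x b.

(** The terms quadratic in the point cancel, so the gap is affine and is interpolated from its
    values at the vertices. *)
Lemma dist_gap_affine_map (a b z : R * R) :
  dist_gap a b (affine_map v u w z) =
  dist_gap a b v * (1 - z.1 - z.2) + dist_gap a b (v.1 + u.1, v.2 + u.2) * z.1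
  + dist_gap a b (v.1 + w.1, v.2 + w.2) * z.2.
Proof. by rewrite /dist_gap /sqdist /affine_map/=; ring. Qed.

(* The bisector of [a] and [b] separates the vertex [v] from the other two, so
   it cuts off the corner whose sides are read off by linear interpolation. *)
Lemma distortion2_corner (a b : R * R) :
  dist_gap a b v < 0 ->
  0 <= dist_gap a b (v.1 + u.1, v.2 + u.2) ->
  0 <= dist_gap a b (v.1 + w.1, v.2 + w.2) ->
  exists s t : R, [/\ 0 < s <= 1, 0 < t <= 1 &
    distortion [fset a; b]%fset = (split_cost s t a b)%:E].
Proof.
set l := dist_gap a b v; set lu := dist_gap a b _; set lw := dist_gap a b _.
move=> l0 lu0 lw0.
have du : 0 < lu - l by lra.
have dw : 0 < lw - l by lra.
pose s := - l / (lu - l); pose t := - l / (lw - l).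
have s01 : 0 < s <= 1.
  by rewrite /s divr_gt0 ?oppr_gt0//= ler_pdivrMr// mul1r; lra.
have t01 : 0 < t <= 1.
  by rewrite /t divr_gt0 ?oppr_gt0//= ler_pdivrMr// mul1r; lra.
have [/andP[s0 _] /andP[t0 _]] := (s01, t01).
have ls : s * (lu - l) = - l by rewrite /s divfK// gt_eqF.
have lt : t * (lw - l) = - l by rewrite /t divfK// gt_eqF.
(* The gap vanishes at the two far ends of the corner, so only its value at [v] remains. *)
have gapE (z : R * R) : dist_gap a b (affine_map v (scl s u) (scl t w) z) = l * (1 - z.1 - z.2).
  rewrite affine_map_scl dist_gap_affine_map /= -/l -/lu -/lw.
  have -> : l * (1 - s * z.1 - t * z.2) + lu * (s * z.1) + lw * (t * z.2) =
    l + s * (lu - l) * z.1 + t * (lw - l) * z.2 by ring.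
  by rewrite ls lt; ring.
exists s, t; split=> //; rewrite -integral_split//.
apply: distortion2_eq_split.
- exact: (@measurable_corner R v u w fr s t s0 t0).
- exact: corner_sub_tri.
- move=> _ [z [z1 [z2 z12]] <-]; rewrite -subr_le0 -/(dist_gap a b _) gapE.
  by rewrite nmulr_rle0//; lra.
- move=> x; rewrite -(frame_tri fr) => -[z [z1 [z2 z12]] <-] zN.
  rewrite -subr_ge0 -/(dist_gap a b _).
  have zE : affine_map v u w z = affine_map v (scl s u) (scl t w) (z.1 / s, z.2 / t).
    by rewrite affine_map_scl /= (mulrC s) (mulrC t) !divfK ?gt_eqF.
  rewrite zE gapE nmulr_rge0//=.
  have [?|zst] := leP (1 - z.1 / s - z.2 / t) 0; first by [].
  (* A strictly positive third barycentric coordinate would put the point inside the corner. *)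
  case: zN; rewrite zE; exists (z.1 / s, z.2 / t) => //=.
  have zs : 0 <= z.1 / s := divr_ge0 z1 (ltW s0).
  have zt : 0 <= z.2 / t := divr_ge0 z2 (ltW t0).
  by rewrite /std_tri/=; split=> //; split=> //; lra.
Qed.

(** An affine gap that is nonpositive at the vertices is nonpositive on the triangle, so [a] serves
    all of it. *)
Lemma distortion2_one_cell (a b : R * R) :
  dist_gap a b v <= 0 ->
  dist_gap a b (v.1 + u.1, v.2 + u.2) <= 0 ->
  dist_gap a b (v.1 + w.1, v.2 + w.2) <= 0 ->
  distortion [fset a; b]%fset = (sqdist (tri_center R) a + 12^-1)%:E.
Proof.
move=> l0 lu0 lw0; rewrite -integral_tri_wdist distortion2.
apply: eq_integral => x /[!inE]; rewrite -(frame_tri fr) => -[z [z1 [z2 z12]] <-].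
congr EFin; apply/min_idPl; rewrite ler_pM2l ?dens_gt0//.
rewrite -subr_le0 -/(dist_gap a b _) dist_gap_affine_map.
have z0 : 0 <= 1 - z.1 - z.2 by lra.
have := mulr_le0_ge0 l0 z0; have := mulr_le0_ge0 lu0 z1; have := mulr_le0_ge0 lw0 z2.
lra.
Qed.

End frame_cost.

(** * The optimal corner *)

(** The inverse of the golden ratio, the positive root of [x^2 = 1 - x]. *)
Definition phi (R : realType) : R := (Num.sqrt 5 - 1) / 2.
Arguments phi R : clear implicits.

Lemma phi_sq (R : realType) : phi R ^+ 2 = 1 - phi R.
Proof.
have s5 : Num.sqrt 5 ^+ 2 = 5 :> R by rewrite sqr_sqrtr.
rewrite /phi; have -> : ((Num.sqrt 5 - 1) / 2) ^+ 2 =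
  (Num.sqrt 5 ^+ 2 - 2 * Num.sqrt 5 + 1) / 4 :> R by field.
by rewrite s5; field.
Qed.

(** At these two bounds the quantity [1/12 - (5 phi - 3) / 3] equals [0.05327675] and [0.05327665],
    the ends of the rounding interval for the quantization error. *)
Lemma phi_bounds (R : realType) :
  61803395%:R / 10 ^+ 8 < phi R < 61803401%:R / 10 ^+ 8.
Proof.
have f2 := phi_sq R.
have f0 : 0 < phi R.
  rewrite divr_gt0// subr_gt0 -[ltLHS]sqrtr1 ltr_sqrt//; lra.
apply/andP; split; rewrite ltNge; apply/negP => h; nra.
Qed.

(* [5 phi - 3 = phi^5], and the difference of the two sides is
   [(r - phi)^2 (r + phi^3)]. *)
Lemma cubic_golden_le (R : realType) (r : R) : 0 <= r ->
  r ^+ 2 * (1 - r) <= (5 * phi R - 3) * (1 + r) ?= iff (r == phi R).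
Proof.
move=> r0; have f2 := phi_sq R; have /andP[fl fu] := phi_bounds R.
have E : (5 * phi R - 3) * (1 + r) - r ^+ 2 * (1 - r) =
    (r - phi R) ^+ 2 * (r + (2 * phi R - 1)).
  (* The expansion isolates each [phi R ^+ 2], so that [phi_sq] lowers the degree in [phi R] to
     one. *)
  have -> : (r - phi R) ^+ 2 * (r + (2 * phi R - 1)) =
    r ^+ 3 - r ^+ 2 - 2 * phi R * r * (2 * phi R - 1) + phi R ^+ 2 * (r + (2 * phi R - 1)) by ring.
  have -> : 2 * phi R * r * (2 * phi R - 1) = 4 * r * phi R ^+ 2 - 2 * r * phi R by ring.
  have -> : phi R ^+ 2 * (r + (2 * phi R - 1)) =
     r * phi R ^+ 2 + 2 * phi R * phi R ^+ 2 - phi R ^+ 2 by ring.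
  rewrite f2.
  have -> : 2 * phi R * (1 - phi R) = 2 * phi R - 2 * phi R ^+ 2 by ring.
  by rewrite f2; ring.
have p0 : 0 < r + (2 * phi R - 1) by lra.
split.
  by rewrite -subr_ge0 E mulr_ge0 ?sqr_ge0// ltW.
rewrite eq_sym -subr_eq0 E mulf_eq0 sqrf_eq0 subr_eq0.
by rewrite (gt_eqF p0) orbF.
Qed.

(* With [x = s + t] and [r^2 = s t] the bracket is the convex function
   [3 - 3 x + x^2 - r^2] of [x] on [2 r, 1 + r^2].  Its value at [2 r] (that is,
   [s = t]) leads to [cubic_golden_le]; its value at [1 + r^2] (a side equal to
   [1]) only gives a gain of at most [1/4]. *)
Lemma corner_gain_le (R : realType) (s t : R) :
  0 < s <= 1 -> 0 < t <= 1 -> s * t < 1 ->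
  s * t * ((1 - s) ^+ 2 + (1 - t) ^+ 2 + (1 - s) * (1 - t)) <=
  3 * (5 * phi R - 3) * (1 - s * t) ?= iff (s == phi R) && (t == phi R).
Proof.
move=> /andP[s0 s1] /andP[t0 t1] st1.
have f2 := phi_sq R; have /andP[fl fu] := phi_bounds R.
pose x := s + t; pose r := Num.sqrt (s * t).
have r2 : r ^+ 2 = s * t by rewrite sqr_sqrtr// mulr_ge0// ltW.
have r0 : 0 < r by rewrite sqrtr_gt0 mulr_gt0.
have r1 : r < 1 by rewrite -(@ltr_pXn2r _ 2)// ?nnegrE ?ler01 ?(ltW r0)// r2 expr1n.
have xr : 2 * r <= x.
  rewrite -(@ler_pXn2r _ 2)// ?nnegrE; try (rewrite /x; lra).
  have := sqr_ge0 (s - t); rewrite exprMn r2 /x; lra.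
have xy : x <= 1 + r ^+ 2.
  have : 0 <= (1 - s) * (1 - t) by rewrite mulr_ge0// subr_ge0.
  by rewrite r2 /x; lra.
have N : (1 - s) ^+ 2 + (1 - t) ^+ 2 + (1 - s) * (1 - t) = 3 - 3 * x + x ^+ 2 - r ^+ 2.
  by rewrite r2 /x; ring.
rewrite N -r2.
have [xs|xl] := leP (x + 2 * r) 3.
(* The bracket at [x] is its value [3 (1 - r)^2] at [2 r] minus [(x - 2 r) (3 - (x + 2 r))], which
   is nonnegative in this case. *)
- have h1 : r ^+ 2 * (3 - 3 * x + x ^+ 2 - r ^+ 2) =
     3 * (1 - r) * (r ^+ 2 * (1 - r)) - r ^+ 2 * ((x - 2 * r) * (3 - (x + 2 * r))) by ring.
  have h2 : 3 * (5 * phi R - 3) * (1 - r ^+ 2) =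
     3 * (1 - r) * ((5 * phi R - 3) * (1 + r)) by ring.
  have [g1 g2] := cubic_golden_le (ltW r0).
  have r1' : 0 < 3 * (1 - r) by lra.
  have g3 : 0 <= r ^+ 2 * ((x - 2 * r) * (3 - (x + 2 * r))).
    by rewrite mulr_ge0 ?sqr_ge0// mulr_ge0 ?subr_ge0.
  have g4 : 3 * (1 - r) * (r ^+ 2 * (1 - r)) <= 3 * (1 - r) * ((5 * phi R - 3) * (1 + r)).
    by rewrite ler_pM2l.
  split; first by rewrite h1 h2; lra.
  apply/eqP/andP => [e|[/eqP es /eqP et]]; last first.
    have rp : r = phi R.
      apply/eqP; rewrite -(@eqrXn2 _ 2)// ?(ltW r0)//; first by rewrite r2 es et.
      lra.
    have xp : x = 2 * r by rewrite /x es et rp; ring.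
    rewrite h1 h2 xp subrr mul0r mulr0 subr0; congr (_ * _).
    by apply/eqP; rewrite g2 rp.
  have e1 : r ^+ 2 * ((x - 2 * r) * (3 - (x + 2 * r))) = 0.
    by move: e; rewrite h1 h2; lra.
  have e2 : 3 * (1 - r) * (r ^+ 2 * (1 - r)) = 3 * (1 - r) * ((5 * phi R - 3) * (1 + r)).
    by move: e; rewrite h1 h2; lra.
  have rp : r = phi R.
    by apply/eqP; rewrite -g2; apply/eqP; apply: (mulfI _ e2); rewrite gt_eqF.
  (* The other zero [x = 3 - 2 r] exceeds the bound [1 + r^2] when [r = phi R]. *)
  have x3 : 3 - (x + 2 * r) != 0.
    rewrite gt_eqF// subr_gt0; move: xy; rewrite rp f2; lra.
  have x2 : x = 2 * r.
    apply/eqP; rewrite -subr_eq0; move/eqP: e1.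
    by rewrite mulf_eq0 sqrf_eq0 (gt_eqF r0) mulf_eq0 (negbTE x3) orbF.
  have : (s - t) ^+ 2 = 0.
    have -> : (s - t) ^+ 2 = x ^+ 2 - 4 * (s * t) by rewrite /x; ring.
    by rewrite x2 -r2; ring.
  move/eqP; rewrite sqrf_eq0 subr_eq0 => /eqP st.
  have : s = r by move: x2; rewrite /x st; lra.
  by rewrite -st rp => ->; rewrite eqxx.
- have h : r ^+ 2 * (3 - 3 * x + x ^+ 2 - r ^+ 2) < 3 * (5 * phi R - 3) * (1 - r ^+ 2).
    have y1 : 0 < 1 - r ^+ 2 by rewrite r2; lra.
    have n1 : 3 - 3 * x + x ^+ 2 - r ^+ 2 <= (1 - r ^+ 2) ^+ 2.
      (* From [r^2 >= 2 r - 1] and [x + 2 r > 3] follows [x + r^2 > 2], the sign of the second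
         factor below. *)
      have := sqr_ge0 (1 - r) => q.
      have : 0 <= (1 + r ^+ 2 - x) * (x + r ^+ 2 - 2).
        by rewrite mulr_ge0 ?subr_ge0//; lra.
      lra.
    (* The bound [1/4] lies strictly below [3 (5 phi - 3)], about [0.2705], so equality cannot occur
       here. *)
    have n2 : r ^+ 2 * (1 - r ^+ 2) <= 4^-1.
      have := sqr_ge0 (1 - 2 * r ^+ 2); lra.
    have n3 : r ^+ 2 * (3 - 3 * x + x ^+ 2 - r ^+ 2) <= r ^+ 2 * (1 - r ^+ 2) ^+ 2.
      by rewrite ler_pM2l// exprn_gt0.
    have n4 : r ^+ 2 * (1 - r ^+ 2) ^+ 2 <= 4^-1 * (1 - r ^+ 2).
      by rewrite expr2 mulrA ler_pM2r.
    apply: le_lt_trans (le_trans n3 n4) _.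
    by rewrite ltr_pM2r//; lra.
  split; first exact: ltW.
  rewrite (lt_eqF h); apply/esym/negbTE/negP => /andP[/eqP es /eqP et].
  have rp : r = phi R.
    apply/eqP; rewrite -(@eqrXn2 _ 2)// ?(ltW r0)//; first by rewrite r2 es et.
    lra.
  by move: xl; rewrite /x es et rp; lra.
Qed.

(** * The golden means and the minimal split cost *)

Definition near_mean (R : realType) (v : R * R) : R * R :=
  (v.1 + phi R * ((tri_center R).1 - v.1), v.2 + phi R * ((tri_center R).2 - v.2)).

(** The centroid of the triangle without the golden corner at [v]; the factor [2 phi - 1] is
    [phi^3]. *)
Definition far_mean (R : realType) (v : R * R) : R * R :=
  ((tri_center R).1 + (2 * phi R - 1) * ((tri_center R).1 - v.1),
   (tri_center R).2 + (2 * phi R - 1) * ((tri_center R).2 - v.2)).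

Definition golden_means (R : realType) (v : R * R) : {fset R * R} :=
  [fset near_mean v; far_mean v]%fset.

Definition V2 (R : realType) : R := 12^-1 - (5 * phi R - 3) / 3.
Arguments V2 R : clear implicits.

Lemma sqdist_eq0 (R : realType) (p q : R * R) : sqdist p q = 0 -> q = p.
Proof.
move/eqP; rewrite paddr_eq0 ?sqr_ge0// !sqrf_eq0 !subr_eq0 => /andP[/eqP e1 /eqP e2].
by rewrite [LHS]surjective_pairing -e1 -e2 -surjective_pairing.
Qed.

Section cost.
Variables (R : realType) (v u w : R * R).
Hypothesis fr : frame v u w.

Local Notation ctr := (corner_centroid v u w).
Local Notation c := (tri_center R).
Local Notation split_cost := (split_cost v u w).

(** The two centroids differ by [((1 - s) u + (1 - t) w) / 3], with [u] and [w] at 60 degrees. *)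
Lemma sqdist_corner_centroid (s t : R) :
  sqdist (ctr s t) c = ((1 - s) ^+ 2 + (1 - t) ^+ 2 + (1 - s) * (1 - t)) / 9.
Proof.
rewrite /sqdist -(frame_c1 fr) -(frame_c2 fr) /corner_centroid /=.
transitivity (((1 - s) ^+ 2 * (u.1 * u.1 + u.2 * u.2) + (1 - t) ^+ 2 * (w.1 * w.1 + w.2 * w.2)
  + 2 * (1 - s) * (1 - t) * (u.1 * w.1 + u.2 * w.2)) / 9); first by field.
by rewrite (frame_u fr) (frame_w fr) (frame_uw fr); field.
Qed.

(* Completing the square at the two conditional means. *)
Lemma split_costE (s t : R) (a b : R * R) :
  (1 - s * t) * (split_cost s t a b - V2 R) =
  s * t * (1 - s * t) * sqdist (ctr s t) a
  + ((1 - s * t) * (b.1 - c.1) + s * t * ((ctr s t).1 - c.1)) ^+ 2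
  + ((1 - s * t) * (b.2 - c.2) + s * t * ((ctr s t).2 - c.2)) ^+ 2
  + (3 * (5 * phi R - 3) * (1 - s * t)
     - s * t * ((1 - s) ^+ 2 + (1 - t) ^+ 2 + (1 - s) * (1 - t))) / 9.
Proof.
have := sqdist_corner_centroid s t.
move/(congr1 (fun y => y * 9)); rewrite divfK ?pnatr_eq0// => <-.
by rewrite /split_cost /V2 /sqdist; move: (ctr s t) c => e d; field.
Qed.

Lemma near_meanE : ctr (phi R) (phi R) = near_mean v.
Proof.
rewrite /corner_centroid /near_mean -(frame_c1 fr) -(frame_c2 fr).
by congr pair; field.
Qed.

Lemma phi01 : 0 < phi R <= 1.
Proof. by have /andP[? ?] := phi_bounds R; apply/andP; split; lra. Qed.

(** One coordinate of the squares in [split_costE] at [s = t = phi R]: it vanishes exactly when [b]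
    is the coordinate of the far mean. *)
Lemma far_meanE (b x e : R) :
  (1 - phi R * phi R) * (b - x) + phi R * phi R * (e + phi R * (x - e) - x) =
  phi R * (b - (x + (2 * phi R - 1) * (x - e))).
Proof.
have -> : phi R * phi R = 1 - phi R by rewrite -expr2 phi_sq.
transitivity (phi R * (b - x) + (1 - phi R * 2 + phi R ^+ 2) * (e - x)); first by ring.
transitivity (phi R * (b - x) + (2 * phi R ^+ 2 - phi R) * (e - x)); last by ring.
by rewrite phi_sq; ring.
Qed.

Lemma split_cost_ge (s t : R) (a b : R * R) : 0 < s <= 1 -> 0 < t <= 1 ->
  V2 R <= split_cost s t a b.
Proof.
move=> s01 t01; have [/andP[s0 s1] /andP[t0 t1]] := (s01, t01).
have /andP[fl fu] := phi_bounds R.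
have : s * t <= 1 by rewrite mulr_ile1// ltW.
rewrite le_eqVlt => /predU1P[st|st]; last first.
  have [g _] := corner_gain_le s01 t01 st.
  have q0 : 0 < 1 - s * t by lra.
  have p0 : 0 < s * t by rewrite mulr_gt0.
  rewrite -subr_ge0 -(pmulr_rge0 _ q0) split_costE.
  rewrite !addr_ge0 ?sqr_ge0//; first by rewrite !mulr_ge0 ?sqdist_ge0// ltW.
  by rewrite divr_ge0// subr_ge0.
(* If [s * t = 1] the corner is the whole triangle and the cost is at least its variance [1/12]. *)
have s1' : s = 1.
  apply/eqP; rewrite eq_le s1/= -st -[leRHS]mulr1 ler_wpM2l// ltW//.
have t1' : t = 1 by move: st; rewrite s1' mul1r.
rewrite s1' t1' /split_cost (corner_centroid1 fr) /V2.
have := sqdist_ge0 c a; lra.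
Qed.

(** The nonnegative terms of [split_costE] all vanish: the gain term fixes [s] and [t], then the
    distance fixes [a] and the squares fix [b]. *)
Lemma split_cost_eq (s t : R) (a b : R * R) : 0 < s <= 1 -> 0 < t <= 1 ->
  split_cost s t a b = V2 R -> a = near_mean v /\ b = far_mean v.
Proof.
move=> s01 t01 e; have [/andP[s0 s1] /andP[t0 t1]] := (s01, t01).
have /andP[fl fu] := phi_bounds R.
have : s * t <= 1 by rewrite mulr_ile1// ltW.
rewrite le_eqVlt => /predU1P[st|st].
  have s1' : s = 1.
    apply/eqP; rewrite eq_le s1/= -st -[leRHS]mulr1 ler_wpM2l// ltW//.
  have t1' : t = 1 by move: st; rewrite s1' mul1r.
  move: e; rewrite s1' t1' /split_cost (corner_centroid1 fr) /V2 => e.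
  by exfalso; have := sqdist_ge0 c a; lra.
have [g ge] := corner_gain_le s01 t01 st.
have q0 : 0 < 1 - s * t by lra.
have p0 : 0 < s * t by rewrite mulr_gt0.
have := split_costE s t a b; rewrite e subrr mulr0.
set A := s * t * (1 - s * t) * _; set B := (_ + _) ^+ 2; set C := (_ + _) ^+ 2.
have A0 : 0 <= A by rewrite !mulr_ge0 ?sqdist_ge0// ltW.
have B0 : 0 <= B := sqr_ge0 _.
have C0 : 0 <= C := sqr_ge0 _.
move=> ABC.
have Gz : s * t * ((1 - s) ^+ 2 + (1 - t) ^+ 2 + (1 - s) * (1 - t)) =
  3 * (5 * phi R - 3) * (1 - s * t) by lra.
have /andP[/eqP sp /eqP tp] : (s == phi R) && (t == phi R) by rewrite -ge Gz.
have Az : A = 0 by lra.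
have Bz : B = 0 by lra.
have Cz : C = 0 by lra.
split.
  rewrite -near_meanE; apply: sqdist_eq0; rewrite -[X in ctr X]sp -tp.
  move/eqP: Az; rewrite mulf_eq0 => /orP[/eqP pq|/eqP->//].
  by have := mulr_gt0 p0 q0; rewrite pq ltxx.
have fn0 : phi R != 0 by rewrite gt_eqF//; lra.
rewrite [LHS]surjective_pairing; congr pair; apply/eqP; rewrite -subr_eq0.
  move/eqP: Bz; rewrite /B sqrf_eq0 sp tp near_meanE /near_mean/= far_meanE.
  by rewrite mulf_eq0 (negbTE fn0).
move/eqP: Cz; rewrite /C sqrf_eq0 sp tp near_meanE /near_mean/= far_meanE.
by rewrite mulf_eq0 (negbTE fn0).
Qed.

Lemma split_cost_golden :
  split_cost (phi R) (phi R) (near_mean v) (far_mean v) = V2 R.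
Proof.
have /andP[fl fu] := phi_bounds R; have f01 := phi01; have [/andP[f0 _]] := f01.
have f2 := phi_sq R.
have ff : phi R * phi R = 1 - phi R by rewrite -expr2.
have st : phi R * phi R < 1 by lra.
have [_ ge] := corner_gain_le f01 f01 st.
have q0 : 1 - phi R * phi R != 0 by rewrite gt_eqF//; lra.
apply/eqP; rewrite -subr_eq0; apply/eqP; apply: (mulfI q0); rewrite mulr0 split_costE.
rewrite near_meanE !far_meanE /= !subrr mulr0 expr0n/=.
rewrite /sqdist !subrr expr0n/= !addr0 mulr0 add0r.
by move: ge; rewrite eqxx/= => /eqP ->; rewrite subrr mul0r.
Qed.

(** Any split bounds the distortion from above, so the golden corner is used without comparing it
    with the bisector. *)
Lemma distortion_golden_le : (distortion (golden_means v) <= (V2 R)%:E)%E.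
Proof.
by rewrite -split_cost_golden; apply: (distortion2_le_split_cost fr); exact: phi01.
Qed.

End cost.

(** * Arbitrary pairs of points *)

Definition cost_spec (R : realType) (a b : R * R) : Prop :=
  exists r : R, [/\ distortion [fset a; b]%fset = r%:E, V2 R <= r &
    r = V2 R -> exists2 v, v \in tri_vertices R & [fset a; b]%fset = golden_means v].

(** Finiteness, lower bound and equality case form one symmetric predicate, so the two points may be
    exchanged in the case analysis. *)
Lemma cost_specC (R : realType) (a b : R * R) : cost_spec a b -> cost_spec b a.
Proof. by rewrite /cost_spec fsetUC. Qed.

Lemma dist_gapC (R : realType) (a b x : R * R) : dist_gap b a x = - dist_gap a b x.
Proof. by rewrite /dist_gap opprB. Qed.

Lemma V2_lt (R : realType) : V2 R < 12^-1.
Proof. by have /andP[? ?] := phi_bounds R; rewrite /V2; lra. Qed.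

Section cost_spec.
Variables (R : realType) (v u w p q : R * R).
Hypotheses (fr : frame v u w) (vT : v \in tri_vertices R).
Hypotheses (pE : p = (v.1 + u.1, v.2 + u.2)) (qE : q = (v.1 + w.1, v.2 + w.2)).

Lemma cost_spec_corner (a b : R * R) :
  dist_gap a b v < 0 -> 0 <= dist_gap a b p -> 0 <= dist_gap a b q ->
  cost_spec a b.
Proof.
rewrite pE qE => l lu lw.
have [s [t [s01 t01 E]]] := distortion2_corner fr l lu lw.
exists (split_cost v u w s t a b); split=> //; first exact: split_cost_ge.
by move=> /(split_cost_eq fr s01 t01)[-> ->]; exists v.
Qed.

Lemma cost_spec_cell (a b : R * R) :
  dist_gap a b v <= 0 -> dist_gap a b p <= 0 -> dist_gap a b q <= 0 ->
  cost_spec a b.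
Proof.
rewrite pE qE => l lu lw; exists (sqdist (tri_center R) a + 12^-1).
have := sqdist_ge0 (tri_center R) a; have := V2_lt R => V a0.
by split; [exact: (distortion2_one_cell fr)|lra|lra].
Qed.

End cost_spec.

Lemma distortion2_spec (R : realType) (a b : R * R) : cost_spec a b.
Proof.
pose p1 : R * R := (0, 0); pose p2 : R * R := (1, 0).
pose p3 : R * R := (2^-1, Num.sqrt 3 / 2).
have v1 : p1 \in tri_vertices R by rewrite !inE eqxx.
have v2 : p2 \in tri_vertices R by rewrite !inE eqxx orbT.
have v3 : p3 \in tri_vertices R by rewrite !inE eqxx !orbT.
have C1 a' b' := @cost_spec_corner R p1 _ _ p2 p3 (frame1 R) v1.
have C2 a' b' := @cost_spec_corner R p2 _ _ p1 p3 (frame2 R) v2.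
have C3 a' b' := @cost_spec_corner R p3 _ _ p1 p2 (frame3 R) v3.
have CC a' b' := @cost_spec_cell R p1 _ _ p2 p3 (frame1 R).
have D1 : forall a' b', dist_gap a' b' p1 < 0 -> 0 <= dist_gap a' b' p2 ->
  0 <= dist_gap a' b' p3 -> cost_spec a' b'.
  by move=> a' b'; apply: C1 => //=; congr pair; lra.
have D2 : forall a' b', dist_gap a' b' p2 < 0 -> 0 <= dist_gap a' b' p1 ->
  0 <= dist_gap a' b' p3 -> cost_spec a' b'.
  by move=> a' b'; apply: C2 => //=; congr pair; lra.
have D3 : forall a' b', dist_gap a' b' p3 < 0 -> 0 <= dist_gap a' b' p1 ->
  0 <= dist_gap a' b' p2 -> cost_spec a' b'.
  by move=> a' b'; apply: C3 => //=; congr pair; lra.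
have DC : forall a' b', dist_gap a' b' p1 <= 0 -> dist_gap a' b' p2 <= 0 ->
  dist_gap a' b' p3 <= 0 -> cost_spec a' b'.
  by move=> a' b'; apply: CC => //=; congr pair; lra.
have N x : dist_gap b a x = - dist_gap a b x := dist_gapC a b x.
(* By the signs at the vertices, either one vertex is separated from the other two, possibly after
   exchanging [a] and [b], or one point serves the whole triangle. *)
have [g1|g1] := leP 0 (dist_gap a b p1); have [g2|g2] := leP 0 (dist_gap a b p2);
  have [g3|g3] := leP 0 (dist_gap a b p3).
- by apply: cost_specC; apply: DC; rewrite N; lra.
- exact: D3.
- exact: D2.
(* After the exchange the isolated vertex needs a strict sign; a zero gap there falls under the
   single-cell case. *)
- have [g|g] := leP (dist_gap a b p1) 0; first by apply: DC => //; exact: ltW.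
  by apply: cost_specC; apply: D1; rewrite N; lra.
- exact: D1.
- have [g|g] := leP (dist_gap a b p2) 0; first by apply: DC => //; exact: ltW.
  by apply: cost_specC; apply: D2; rewrite N; lra.
- have [g|g] := leP (dist_gap a b p3) 0; first by apply: DC => //; exact: ltW.
  by apply: cost_specC; apply: D3; rewrite N; lra.
- by apply: DC; exact: ltW.
Qed.

(** * Optimal sets and the quantization error *)

Lemma fset_card_le2 (K : choiceType) (A : {fset K}) : (#|` A| <= 2)%N ->
  A = fset0 \/ exists a b, A = [fset a; b]%fset.
Proof.
have [->|[a aA]] := fset_0Vmem A; first by left.
rewrite (cardfsD1 a) aA add1n ltnS => A1; right; exists a.
have AE : A = (a |` (A `\ a))%fset by rewrite fsetD1K.
have [A0|[b bA]] := fset_0Vmem (A `\ a)%fset.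
  (* A singleton is the pair with both members equal to [a]. *)
  by exists a; rewrite AE A0 fsetUid fsetU0.
exists b; rewrite AE; congr (_ |` _)%fset.
move: A1; rewrite (cardfsD1 b) bA add1n ltnS leqn0 cardfs_eq0 => /eqP A0.
by rewrite -(fsetD1K bA) A0 fsetU0.
Qed.

(** The empty minimum is [+oo], hence above the cost of the center, whose integral is the variance
    [1/12]. *)
Lemma distortion_fset0 (R : realType) : ((12^-1)%:E <= distortion (fset0 : {fset R * R}))%E.
Proof.
have := integral_tri_wdist (frame1 R) (tri_center R).
rewrite {1}/sqdist !subrr expr0n/= !add0r => <-.
apply: ge0_le_integral.
- exact: measurable_tri.
- by move=> x _; rewrite lee_fin wdist_ge0.
- by apply/measurable_EFinP; exact: measurable_wdist.
- rewrite (_ : (fun _ => _) = cst +oo%E); first exact: measurable_cst.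
  by apply/funext => x; rewrite /mindist big_nil/= gt0_muley// lte_fin dens_gt0.
- by move=> x _; rewrite /mindist big_nil/= gt0_muley ?leey// lte_fin dens_gt0.
Qed.

Lemma V2_le_distortion (R : realType) (alpha : {fset R * R}) :
  (#|` alpha| <= 2)%N -> ((V2 R)%:E <= distortion alpha)%E.
Proof.
move=> /fset_card_le2[->|[a [b ->]]].
  by apply: le_trans (distortion_fset0 R); rewrite lee_fin ltW// V2_lt.
by have [r [-> Vr _]] := distortion2_spec a b; rewrite lee_fin.
Qed.

Lemma vertex_frame (R : realType) (v : R * R) : v \in tri_vertices R ->
  exists u w, frame v u w.
Proof.
rewrite !inE => /or3P[]/eqP->.
- by do 2 eexists; exact: frame1.
- by do 2 eexists; exact: frame2.
- by do 2 eexists; exact: frame3.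
Qed.

Lemma card_golden_means (R : realType) (v : R * R) : (#|` golden_means v| <= 2)%N.
Proof. by rewrite cardfs2; case: (_ != _). Qed.

Lemma distortion_golden (R : realType) (v : R * R) : v \in tri_vertices R ->
  distortion (golden_means v) = (V2 R)%:E.
Proof.
move=> /vertex_frame[u [w fr]]; apply/eqP; rewrite eq_le.
by rewrite (distortion_golden_le fr)/= V2_le_distortion// card_golden_means.
Qed.

Lemma Vn2E (R : realType) : Vn R 2 = (V2 R)%:E.
Proof.
apply/eqP; rewrite eq_le; apply/andP; split.
  apply: ereal_inf_lbound; exists (golden_means (0, 0)); first exact: card_golden_means.
  by apply: distortion_golden; rewrite !inE eqxx.
by apply: le_ereal_inf_tmp => _ [alpha ca <-]; exact: V2_le_distortion.
Qed.

Lemma optimal_set2P (R : realType) (alpha : {fset R * R}) :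
  optimal_set 2 alpha <-> exists2 v, v \in tri_vertices R & alpha = golden_means v.
Proof.
rewrite /optimal_set Vn2E; split=> [[/fset_card_le2[->|[a [b ->]]] E]|[v vT ->]].
- by have := distortion_fset0 R; rewrite E lee_fin leNgt V2_lt.
- have [r [Er _]] := distortion2_spec a b; apply.
  by move: E; rewrite Er => -[].
- by rewrite card_golden_means distortion_golden.
Qed.

(** * Centroids of the golden cut *)

(** In each comparison the near mean of the first vertex differs from both means of the second,
    already in the first coordinate. *)
Lemma golden_means_neq (R : realType) :
  let v1 : R * R := (0, 0) in let v2 : R * R := (1, 0) in
  let v3 : R * R := (2^-1, Num.sqrt 3 / 2) in
  [/\ golden_means v1 != golden_means v2, golden_means v1 != golden_means v3 &
      golden_means v2 != golden_means v3].
Proof.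
move=> v1 v2 v3; have /andP[fl fu] := phi_bounds R.
have pk : 0 < phi R * Num.sqrt 3 by rewrite mulr_gt0 ?sqrt3_gt0//; lra.
have mem (v v' : R * R) : golden_means v = golden_means v' ->
    near_mean v = near_mean v' \/ near_mean v = far_mean v'.
  move=> e; have : near_mean v \in golden_means v' by rewrite -e !inE eqxx.
  by rewrite !inE => /orP[]/eqP; [left|right].
by split; apply/eqP => /mem[]; rewrite /near_mean /far_mean /tri_center/= => -[]; lra.
Qed.

Lemma small_triE (R : realType) (v u w : R * R) (s : R) :
  frame v u w -> small_tri v s = corner v u w s s.
Proof.
move=> fr; rewrite /small_tri -(frame_tri fr) /corner image_comp.
apply: eq_imagel => z _.
by rewrite /affine_map /scl /=; congr pair; ring.
Qed.

Lemma leb2E (R : realType) (A : set (R * R)) :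
  measurable (A : set (plane R)) ->
  leb2 R A = (\int[leb2 R]_(x in A) 1%:E)%E.
Proof. by move=> mA; rewrite integral_cst// mul1e. Qed.

Section corner_measure.
Variables (R : realType) (v u w : R * R) (s : R).
Hypotheses (fr : frame v u w) (s01 : 0 < s <= 1).

Let s0 : 0 < s. Proof. by case/andP: s01. Qed.
Let mS := @measurable_corner R v u w fr s s s0 s0.
Let ST := corner_sub_tri fr s01 s01.

(** The constant [1] gives areas and the two projections give centroids; all are nonnegative on the
    triangle. *)
Let integrals (f : R * R -> R) (c0 c1 c2 : R) :
  measurable_fun (setT : set (plane R)) f ->
  (forall z, tri R z -> 0 <= f z) ->
  (forall z, f (affine_map v u w z) = c0 + c1 * z.1 + c2 * z.2) ->
  let I := Num.sqrt 3 / 4 * (c0 + (c1 + c2) / 3) in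
  let J := Num.sqrt 3 / 4 * (s ^+ 2 * (c0 + s * ((c1 + c2) / 3))) in
  (\int[leb2 R]_(x in corner v u w s s) (f x)%:E = J%:E)%E /\
  (\int[leb2 R]_(x in tri R `\` corner v u w s s) (f x)%:E = (I - J)%:E)%E.
Proof.
move=> mf f0 fE I J.
have EJ : (\int[leb2 R]_(x in corner v u w s s) (f x)%:E = J%:E)%E.
  rewrite (@integral_corner _ _ _ _ fr s s c0 (c1 * s) (c2 * s) 0 0 0)//.
  - by congr EFin; rewrite /J; field.
  - by move=> z /ST; exact: f0.
  - by move=> z; rewrite affine_map_scl fE /quad/=; ring.
split=> //; apply: integral_setD_tri EJ => //.
rewrite (@integral_tri _ _ _ _ fr c0 c1 c2 0 0 0)//.
  by congr EFin; rewrite /I; field.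
by move=> z; rewrite fE /quad; ring.
Qed.

Lemma leb2_corner : leb2 R (corner v u w s s) = (Num.sqrt 3 / 4 * s ^+ 2)%:E /\
  leb2 R (tri R `\` corner v u w s s) = (Num.sqrt 3 / 4 * (1 - s ^+ 2))%:E.
Proof.
have [] := @integrals (fun=> 1) 1 0 0 (measurable_cst _) (fun _ _ => ler01).
  by move=> z; rewrite !mul0r !addr0.
have mT := measurableD (@measurable_tri R) mS.
rewrite -!leb2E// => -> ->.
by split; congr EFin; field.
Qed.

Lemma centroid_corner :
  s < 1 ->
  centroid (corner v u w s s) = corner_centroid v u w s s /\
  centroid (tri R `\` corner v u w s s) =
    (((tri_center R).1 - s ^+ 2 * (corner_centroid v u w s s).1) / (1 - s ^+ 2),
     ((tri_center R).2 - s ^+ 2 * (corner_centroid v u w s s).2) / (1 - s ^+ 2)).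
Proof.
move=> s1.
have k0 : Num.sqrt 3 != 0 :> R by rewrite gt_eqF// sqrt3_gt0.
have sn0 : s != 0 by rewrite gt_eqF.
have q0 : 1 - s ^+ 2 != 0 by rewrite gt_eqF// subr_gt0 expr_lt1// ltW.
have t1 (z : R * R) : tri R z -> 0 <= z.1 by move=> /in_triE[]; lra.
have t2 (z : R * R) : tri R z -> 0 <= z.2 by case.
have [A1 B1] := @integrals fst v.1 u.1 w.1 measurable_fst t1
  (fun z => ltac:(rewrite /affine_map/=; ring)).
have [A2 B2] := @integrals snd v.2 u.2 w.2 measurable_snd t2
  (fun z => ltac:(rewrite /affine_map/=; ring)).
have [LA LB] := leb2_corner.
rewrite /centroid A1 B1 A2 B2 LA LB -(frame_c1 fr) -(frame_c2 fr) /corner_centroid /=.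
by split; congr pair; field; rewrite ?k0 ?sn0 ?q0.
Qed.

End corner_measure.

(** Since the golden ratio is [1 + phi], the equation reads [(2 + phi) s^2 = 1], and
    [(2 + phi) phi^2 = 1] as well. *)
Lemma golden_scale (R : realType) (s : R) : 0 < s ->
  1 - s ^+ 2 = golden R * s ^+ 2 -> s = phi R.
Proof.
move=> s0 e; have /andP[fl fu] := phi_bounds R; have f2 := phi_sq R.
have gE : golden R = 1 + phi R by rewrite /golden /phi; field.
apply/eqP; rewrite -(@eqrXn2 _ 2)//; [|exact: ltW|lra].
have g0 : 2 + phi R != 0 by rewrite gt_eqF//; lra.
apply/eqP; apply: (mulfI g0).
transitivity (1 : R); first by move: e; rewrite gE; lra.
by rewrite f2; move: f2; rewrite expr2; lra.
Qed.

Theorem theorem3p1 (R : realType) :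
  (* exactly three optimal sets of two-means *)
  (exists alpha1 alpha2 alpha3 : {fset (R * R)},
      [/\ alpha1 != alpha2, alpha1 != alpha3, alpha2 != alpha3 &
        forall alpha : {fset (R * R)},
          optimal_set 2 alpha <-> [\/ alpha = alpha1, alpha = alpha2 | alpha = alpha3]])
  /\
  (* V_2(P) = 0.0532767 to seven decimal places (rounded) *)
  ((5327665%:R / 10 ^+ 8 : R)%:E <= Vn R 2 /\ Vn R 2 < (5327675%:R / 10 ^+ 8 : R)%:E)%E
  /\
  (* the golden-ratio cut parallel to a side gives an optimal set *)
  (forall (v : R * R) (s : R),
      v \in tri_vertices R -> 0 < s < 1 ->
      let S := small_tri v s in
      let Tz := tri R `\` S in
      leb2 R Tz = ((golden R)%:E * leb2 R S)%E ->
      optimal_set 2 [fset centroid Tz; centroid S]%fset).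
Proof.
have /andP[fl fu] := phi_bounds R.
split; last split.
- have [n12 n13 n23] := golden_means_neq R.
  exists (golden_means (0, 0)), (golden_means (1, 0)),
    (golden_means (2^-1, Num.sqrt 3 / 2)); split=> // alpha.
  rewrite optimal_set2P; split=> [[v + ->]|].
    by rewrite !inE => /or3P[]/eqP->; [exact: Or31|exact: Or32|exact: Or33].
  by case=> ->; eexists; try reflexivity; rewrite !inE eqxx ?orbT.
- by rewrite Vn2E lee_fin lte_fin /V2; split; lra.
- move=> v s vT /andP[s0 s1]; have [u [w fr]] := vertex_frame vT.
  rewrite (small_triE s fr) => S Tz.
  have s01 : 0 < s <= 1 by rewrite s0 ltW.
  have [LS LT] := leb2_corner fr s01.
  rewrite /S /Tz LS LT -EFinM => -[] e.
  have sp : s = phi R.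
    apply: golden_scale => //.
    apply: (@mulfI _ (Num.sqrt 3 / 4)); last by rewrite e; ring.
    by rewrite gt_eqF// divr_gt0// sqrt3_gt0.
  have [-> ->] := centroid_corner fr s01 s1.
  apply/optimal_set2P; exists v => //; rewrite /golden_means fsetUC sp (near_meanE fr).
  congr [fset _; _]%fset.
  have f2 := phi_sq R; have fn0 : phi R != 0 by rewrite gt_eqF//; lra.
  (* In each coordinate the centroid of the trapezoid is the far mean; the denominator [1 - phi^2]
     is [phi]. *)
  have E (c x : R) : (c - phi R ^+ 2 * (x + phi R * (c - x))) / (1 - phi R ^+ 2) =
      c + (2 * phi R - 1) * (c - x).
    rewrite f2; have -> : 1 - (1 - phi R) = phi R by ring.
    apply: (mulIf fn0); rewrite divfK//.
    transitivity (phi R * c + (1 - phi R * 2 + phi R ^+ 2) * (c - x)); first by ring.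
    transitivity (phi R * c + (2 * phi R ^+ 2 - phi R) * (c - x)); last by ring.
    by rewrite f2; ring.
  by rewrite /far_mean /near_mean /= -!E.
Qed.
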